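(* Let $n\ge 1$ and $r, t \ge 2$ be integers. There exists a measurable partition \[ \mathbb{T}^n = \bigcup_{i=1}^r E_i \] of the $n$-dimensional torus such that for every measurable cover of $\mathbb{T}^n$ by $t$ sets, \[ \mathbb{T}^n \subset F_1 \cup \cdots \cup F_t, \] there exist an index $m \in \{1,\dots,t\}$ and an element $\theta\in\mathbb{T}^n$ such that \[ \mu_n\big(R_{\theta}(F_m) \cap E_i\big) > 0 \quad\text{for all } 1\le i\le r. \]
   Context: $\mathbb{T}^n = (\mathbb{R}/\mathbb{Z})^n$ is the $n$-dimensional torus, a compact abelian group, and $\mu_n$ is its Haar probability measure (identifying $\mathbb{T}^n \cong C\times\mathbb{T}^{n-1}$ with $C=\mathbb{R}/\mathbb{Z}$, one has $\mu_n=\mu_1\times\mu_{n-1}$). For $\theta\in\mathbb{T}^n$, $R_\theta:\mathbb{T}^n\to\mathbb{T}^n$ is the translation $x\mapsto x+\theta$, and $R_\theta(F)$ denotes the image of $F\subset\mathbb{T}^n$. A measurable partition is a decomposition into pairwise disjoint measurable sets; a measurable cover consists of measurable subsets $F_1,\dots,F_t$ of $\mathbb{T}^n$, not necessarily disjoint. The partition $\{E_i\}$ may depend on $n$, $r$ and $t$ but not on the cover. *)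

(* Defs.v *)
From HB Require Import structures.
From mathcomp Require Import all_boot all_order all_algebra ring_quotient.
From mathcomp Require Import lra.
From mathcomp Require Import all_classical all_reals all_analysis measurable_realfun.

Set Implicit Arguments.
Unset Strict Implicit.
Unset Printing Implicit Defensive.

Import Order.TTheory GRing.Theory Num.Theory.
Import numFieldNormedType.Exports.

Local Open Scope classical_set_scope.
Local Open Scope ring_scope.
Local Open Scope quotient_scope.

(* Num.int is a qualifier; quotients need a bare predicate carrying the closure
   structure. *)
Definition ints (R : realType) : {pred R} := fun x => x \is a Num.int.

Fact ints_zmod_closed (R : realType) : zmod_closed (@ints R).
Proof. by split=> [|x y]; [exact: rpred0|exact: rpredB]. Qed.

HB.instance Definition _ (R : realType) :=
  GRing.isZmodClosed.Build R (@ints R) (@ints_zmod_closed R).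

Definition circle (R : realType) : Type := @Quotient.quot R (@ints R).

HB.instance Definition _ (R : realType) := Quotient.on (circle R).
HB.instance Definition _ (R : realType) := GRing.Zmodule.on (circle R).

(* Quotient topology, stated directly so that it sits on the group structure
   already carried by circle R; the measurable sets are the Borel sets. *)
Section circle_topology.
Variable R : realType.

Let circle_open (U : set (circle R)) : Prop :=
  open (\pi_(circle R) @^-1` U : set R).

Let circle_openT : circle_open setT.
Proof. by rewrite /circle_open preimage_setT; exact: openT. Qed.

Let circle_openI : setI_closed circle_open.
Proof. by move=> U V; exact: openI. Qed.

Let circle_open_bigcup I (f : I -> set (circle R)) :
  (forall i, circle_open (f i)) -> circle_open (\bigcup_i f i).
Proof. by move=> fo; apply: bigcup_open => i _; exact: fo. Qed.

HB.instance Definition _ := isPointed.Build (circle R) 0.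

HB.instance Definition _ := isOpenTopological.Build (circle R)
  circle_openT circle_openI circle_open_bigcup.

HB.instance Definition _ := Measurable.copy (circle R)
  (g_sigma_algebraType (@open (circle R))).

End circle_topology.

(* Matrices carry the entrywise group structure and the product topology; the
   measurable sets are again the Borel sets. *)
Definition torus (R : realType) (n : nat) : Type := 'rV[circle R]_n.

HB.instance Definition _ (R : realType) (n : nat) :=
  GRing.Zmodule.on (torus R n).
HB.instance Definition _ (R : realType) (n : nat) :=
  Topological.on (torus R n).
HB.instance Definition _ (R : realType) (n : nat) :=
  isPointed.Build (torus R n) 0.
HB.instance Definition _ (R : realType) (n : nat) :=
  Measurable.copy (torus R n) (g_sigma_algebraType (@open (torus R n))).

Definition circle_pi (R : realType) : measurableTypeR R -> circle R :=
  \pi_(circle R).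

Definition torus_cons (R : realType) (n : nat) (cx : circle R * torus R n) :
  torus R n.+1 := row_mx (const_mx cx.1 : 'rV_1) cx.2.

Section borel.
Variable R : realType.
Implicit Types (n : nat).

Lemma circle_openE (U : set (circle R)) :
  open U = open (\pi_(circle R) @^-1` U : set R).
Proof. by []. Qed.

Lemma circle_piD (x y : R) :
  \pi_(circle R) (x + y) = \pi_(circle R) x + \pi_(circle R) y.
Proof. exact: (@pi_addr _ _ _ _ _ (Quotient.quot (@ints R))). Qed.

Lemma circle_pi_eq (x y : R) :
  \pi_(circle R) x = \pi_(circle R) y <-> x - y \is a Num.int.
Proof.
have -> : (x - y \is a Num.int) = (x - y \in @ints R) by [].
by rewrite (Quotient.idealrBE (@ints R)); split => [/eqP|/eqP].
Qed.

Lemma circle_pi_int (k : int) (x : R) :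
  \pi_(circle R) (x + k%:~R) = \pi_(circle R) x.
Proof. by apply/circle_pi_eq; rewrite addrAC subrr add0r intr_int. Qed.

Lemma measurable_open (T : ptopologicalType) (U : set T) :
  open U -> @measurable _ (g_sigma_algebraType (@open T)) U.
Proof. exact: sub_sigma_algebra. Qed.

Lemma measurable_circle_pi : measurable_fun setT (@circle_pi R).
Proof.
apply: (@measurability _ _ _ _ _ _ (@open (circle R))) => // _ [U oU <-].
by rewrite setTI; exact: measurable_realfun.open_measurable.
Qed.

HB.instance Definition _ := isMeasurableFun.Build _ _ _ _ (@circle_pi R)
  measurable_circle_pi.

Definition circle_base (pq : rat * rat) : set (circle R) :=
  \pi_(circle R) @` `]ratr pq.1, ratr pq.2[%classic.

Lemma circle_pi_open (V : set R) : open V -> open (\pi_(circle R) @` V).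
Proof.
move=> oV; rewrite circle_openE.
rewrite (_ : _ @^-1` _ = \bigcup_(k : int) ((fun x : R => x - k%:~R) @^-1` V)).
  apply: bigcup_open => k _; apply: open_comp => // x _.
  by apply: continuousB; [exact: cvg_id|exact: cvg_cst].
apply/seteqP; split => [x [v Vv /circle_pi_eq]|x [k _ Vx]].
  move=> /intrP[k vxk]; exists (- k) => //=.
  by rewrite mulrNz opprK -vxk addrC subrK.
by exists (x - k%:~R) => //; rewrite -mulrNz circle_pi_int.
Qed.

Lemma circle_base_open pq : open (circle_base pq).
Proof. by apply: circle_pi_open; exact: itv_open. Qed.

Lemma rat_itv_base (V : set R) (s : R) : open V -> V s ->
  exists2 pq : rat * rat, (`]ratr pq.1, ratr pq.2[%classic : set R) s &
    (`]ratr pq.1, ratr pq.2[%classic : set R) `<=` V.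
Proof.
move=> oV Vs; have /nbhs_ballP[e /= e0 eV] : nbhs s V.
  by apply: open_nbhs_nbhs.
have [p] := @rat_in_itvoo R (s - e) s ltac:(by rewrite ltrBlDr ltrDl).
have [q] := @rat_in_itvoo R s (s + e) ltac:(by rewrite ltrDl).
rewrite !in_itv/= => /andP[sq qe] /andP[ep ps].
exists (p, q); first by rewrite /= in_itv/= ps.
move=> x /=; rewrite in_itv/= => /andP[px xq]; apply: eV.
by rewrite ball_itv/= in_itv/= (lt_trans ep px) (lt_trans xq qe).
Qed.

Lemma circle_baseP (U : set (circle R)) (x : circle R) : open U -> U x ->
  exists2 pq, circle_base pq x & circle_base pq `<=` U.
Proof.
rewrite circle_openE => oU Ux.
have [|pq spq pqU] := @rat_itv_base _ (repr x) oU.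
  by rewrite /= reprK.
exists pq; first by exists (repr x) => //; rewrite reprK.
by move=> _ [t /pqU Ut <-].
Qed.

Lemma countable_bigcup_measurable d (T : measurableType d) (I : countType)
    (D : set I) (F : I -> set T) :
  (forall i, measurable (F i)) -> measurable (\bigcup_(i in D) F i).
Proof.
move=> mF; rewrite bigcup_mkcond; apply: countable_bigcupT_measurable => // i.
by case: ifP.
Qed.

Lemma measurable_circleD : measurable_fun setT
  (fun xy : circle R * circle R => xy.1 + xy.2).
Proof.
apply: (@measurability _ _ _ _ _ _ (@open (circle R))) => // _ [U oU <-].
rewrite setTI.
pose D := [set ab : (rat * rat) * (rat * rat) |
  circle_base ab.1 `*` circle_base ab.2 `<=`
  (fun xy : circle R * circle R => xy.1 + xy.2) @^-1` U].
rewrite (_ : _ @^-1` _ = \bigcup_(ab in D) (circle_base ab.1 `*` circle_base ab.2)).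
  apply: countable_bigcup_measurable => ab; apply: measurableX;
    by apply: measurable_open; exact: circle_base_open.
apply/seteqP; split => [[x y] /= Uxy|xy [ab abD]]; last exact: abD.
rewrite -[x]reprK -[y]reprK in Uxy *.
move: (repr x) (repr y) Uxy => s t; rewrite -circle_piD => Ust.
have [e /= e0 eU] : exists2 e : R, 0 < e & ball (s + t) e `<=` \pi_(circle R) @^-1` U.
  by apply/nbhs_ballP/open_nbhs_nbhs.
have e20 : 0 < e / 2 by rewrite divr_gt0.
have [a sa aD] := @rat_itv_base (ball s (e / 2)) s (ball_open _ _) (ballxx _ e20).
have [b tb bD] := @rat_itv_base (ball t (e / 2)) t (ball_open _ _) (ballxx _ e20).
exists (a, b); last by split; [exists s|exists t].
move=> [x' y'] /= [[s' /aD s's <-] [t' /bD t't <-]]; rewrite -circle_piD.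
apply: eU; move: s's t't; rewrite !ball_itv/= !in_itv/=.
by move=> /andP[? ?] /andP[? ?]; apply/andP; split; lra.
Qed.

Lemma torus_nbhsP n (x : torus R n) (A : set (torus R n)) :
  nbhs x A <-> exists2 P : 'I_n -> set (circle R),
    (forall i, nbhs (x 0 i) (P i)) & [set y : torus R n | forall i, P i (y 0 i)] `<=` A.
Proof.
split=> [[P xP PA]|[P xP PA]].
  exists (P 0) => [i|y Py]; first exact: xP.
  by apply: PA => i j; rewrite ord1.
by exists (fun=> P) => [i j|y Py]; [rewrite ord1|apply: PA].
Qed.

Definition torus_base n (g : {ffun 'I_n -> rat * rat}) : set (torus R n) :=
  [set x | forall i, circle_base (g i) (x 0 i)].

Lemma torus_baseP n (U : set (torus R n)) (x : torus R n) : open U -> U x ->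
  exists2 g, torus_base g x & torus_base g `<=` U.
Proof.
move=> oU Ux; have /torus_nbhsP[P xP PU] : nbhs x U by apply: open_nbhs_nbhs.
have /choice[g gP] i : exists pq, circle_base pq (x 0 i) /\ circle_base pq `<=` P i.
  move: (xP i); rewrite nbhsE => -[V [oV Vx] VP].
  have [pq ? pqV] := circle_baseP oV Vx.
  by exists pq; split => //; exact: subset_trans VP.
exists [ffun i => g i] => [i|y gy]; first by rewrite ffunE; exact: (gP i).1.
by apply: PU => i; apply: (gP i).2; have := gy i; rewrite ffunE.
Qed.

Lemma measurable_torus d (T : measurableType d) n (f : T -> torus R n) :
  (forall i, measurable_fun setT (fun t => f t 0 i)) -> measurable_fun setT f.
Proof.
move=> mf.
apply: (@measurability _ _ _ _ _ _ (@open (torus R n))) => // _ [U oU <-].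
rewrite setTI.
pose D := [set g : {ffun 'I_n -> rat * rat} | torus_base g `<=` U].
rewrite (_ : _ @^-1` _ = \bigcup_(g in D) (f @^-1` torus_base g)).
  apply: countable_bigcup_measurable => g.
  rewrite (_ : _ @^-1` _ = \bigcap_(i in [set: 'I_n]) ((fun t => f t 0 i) @^-1` circle_base (g i))).
    apply: fin_bigcap_measurable => // i _.
    rewrite -[X in measurable X]setTI; apply: mf => //.
    by apply: measurable_open; exact: circle_base_open.
  by apply/seteqP; split => [t ft i _|t ft i]; exact: ft.
apply/seteqP; split => [t /= Uft|t [g gU] /= /gU //].
by have [g ? ?] := torus_baseP oU Uft; exists g.
Qed.

Lemma torus_coord_open n (i : 'I_n) (U : set (circle R)) :
  open U -> open ((fun x : torus R n => x 0 i) @^-1` U).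
Proof.
move=> oU; rewrite openE => x /= Ux.
apply/torus_nbhsP; exists (fun j => if j == i then U else setT).
  move=> j; case: eqP => [->|_]; last exact: filterT.
  exact: open_nbhs_nbhs.
by move=> y /(_ i); rewrite eqxx.
Qed.

Lemma measurable_torus_coord n (i : 'I_n) :
  measurable_fun setT (fun x : torus R n => x 0 i).
Proof.
apply: (@measurability _ _ _ _ _ _ (@open (circle R))) => // _ [U oU <-].
by rewrite setTI; apply: measurable_open; exact: torus_coord_open.
Qed.

Lemma measurable_torusD n : measurable_fun setT
  (fun xy : torus R n * torus R n => xy.1 + xy.2).
Proof.
apply: measurable_torus => i.
rewrite (_ : (fun _ => _) = (fun xy : circle R * circle R => xy.1 + xy.2) \o
  (fun xy : torus R n * torus R n => (xy.1 0 i, xy.2 0 i))).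
  apply: measurableT_comp; first exact: measurable_circleD.
  by apply: measurable_fun_pair; apply: (measurableT_comp (measurable_torus_coord i)).
by apply/funext => xy /=; rewrite mxE.
Qed.

Lemma measurable_torus_cons n : measurable_fun setT (@torus_cons R n).
Proof.
apply: measurable_torus => i; rewrite -[i](@splitK 1 n).
case: (@fintype.split 1 n i) => j /=.
  rewrite (_ : (fun _ => _) = fst)//.
  by apply/funext => cx; rewrite (@row_mxEl _ 1 1 n) mxE.
rewrite (_ : (fun _ => _) = (fun x : torus R n => x 0 j) \o snd).
  by apply: measurableT_comp => //; exact: measurable_torus_coord.
by apply/funext => cx; rewrite /= (@row_mxEr _ 1 1 n).
Qed.

HB.instance Definition _ n := isMeasurableFun.Build _ _ _ _ (@torus_cons R n)
  (@measurable_torus_cons n).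

End borel.

(* Pushforward of the uniform probability on [0, 1] along R -> R/Z. *)
Definition circle_haar (R : realType) : probability (circle R) R :=
  distribution (uniform_prob (@ltr01 R)) (@circle_pi R).

(* Iterated product measure; torus_haar_rotation and torus_haar_unique below show
   that it is the unique translation-invariant Borel probability measure. *)
Fixpoint torus_haar (R : realType) (n : nat) : probability (torus R n) R :=
  match n with
  | 0 => dirac (0 : torus R 0)
  | n'.+1 => distribution (circle_haar R \x torus_haar R n')%E (@torus_cons R n')
  end.

Definition rotation (R : realType) (n : nat) (theta x : torus R n) :
  torus R n := x + theta.

Section haar.
Variable R : realType.
Implicit Types (n : nat).

Local Notation lambda := (@lebesgue_measure R).

Lemma lebesgue_measure_shift (a : R) (A : set (measurableTypeR R)) :
  measurable A -> lambda ((fun x => x + a) @^-1` A) = lambda A.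
Proof.
move=> mA.
have mf : @measurable_fun _ _ (measurableTypeR R) (measurableTypeR R) setT
    (fun x => x + a).
  by apply: measurable_funD.
pose f : {mfun measurableTypeR R >-> measurableTypeR R} :=
  HB.pack (fun x : measurableTypeR R => x + a : measurableTypeR R)
   (isMeasurableFun.Build _ _ _ _ _ mf).
apply/esym.
apply: (@lebesgue_measure_unique R (pushforward lambda f)) => // _ [[b c] _ <-] /=.
rewrite /pushforward (_ : _ @^-1` _ = `]b - a, c - a]%classic).
  by rewrite !lebesgue_measure_itv/= !lte_fin ltrD2r -!EFinB opprB addrA addrNK.
by apply/seteqP; split => x /=; rewrite !in_itv/= ltrBlDr lerBrDr.
Qed.

Lemma circle_haarE (A : set (circle R)) : measurable A ->
  circle_haar R A = lambda (\pi_(circle R) @^-1` A `&` `[0, 1[%classic).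
Proof.
move=> mA; have mB : measurable (@circle_pi R @^-1` A).
  by rewrite -[X in measurable X]setTI; exact: measurable_circle_pi.
rewrite /circle_haar/= /distribution /pushforward /uniform_prob.
rewrite integral_uniform_pdf (eq_integral (cst 1%E)); last first.
  move=> x; rewrite inE/= => -[_]; rewrite in_itv/= /uniform_pdf => ->.
  by rewrite subr0 invr1.
rewrite integral_cst ?mul1e; last exact: measurableI.
rewrite -(@setUitv1 _ _ (BLeft 0) 1 true) ?bnd_simp// setIUr measureU0//.
- exact: measurableI.
- exact: measurableI.
- apply: (subset_measure0 _ _ _ (lebesgue_measure_set1 1)) => //.
  exact: measurableI.
Qed.

Lemma torus_rotationE n (theta : torus R n) (A : set (torus R n)) :
  rotation theta @` A = (fun x : torus R n => x - theta) @^-1` A.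
Proof.
apply/seteqP; split => [_ [x Ax <-]/=|x /= Ax]; first by rewrite /rotation addrK.
by exists (x - theta) => //; rewrite /rotation subrK.
Qed.


Lemma measurable_torus_shift n (theta : torus R n) :
  measurable_fun setT (fun x : torus R n => x + theta).
Proof.
rewrite (_ : (fun _ => _) = (fun xy : torus R n * torus R n => xy.1 + xy.2) \o
   (fun x : torus R n => (x, theta)))//.
apply: measurableT_comp; first exact: measurable_torusD.
exact: pair2_measurable.
Qed.

Lemma measurable_circle_shift (c : circle R) :
  measurable_fun setT (fun x : circle R => x + c).
Proof.
rewrite (_ : (fun _ => _) = (fun xy : circle R * circle R => xy.1 + xy.2) \o
   (fun x : circle R => (x, c)))//.
apply: measurableT_comp; first exact: measurable_circleD.
exact: pair2_measurable.
Qed.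

Lemma circle_haar_shift (c : circle R) (A : set (circle R)) : measurable A ->
  circle_haar R ((fun x : circle R => x + c) @^-1` A) = circle_haar R A.
Proof.
move=> mA; rewrite !circle_haarE//; last first.
  by rewrite -[X in measurable X]setTI; exact: measurable_circle_shift.
set B := \pi_(circle R) @^-1` A.
have mB : measurable B.
  by rewrite -[X in measurable X]setTI; exact: measurable_circle_pi.
pose t : R := repr c - (Num.floor (repr c))%:~R.
have ct : c = \pi_(circle R) t by rewrite /t -mulrNz circle_pi_int reprK.
have /andP[t0 t1] : 0 <= t < 1.
  by rewrite /t subr_ge0 ltrBlDr -{2}[1]/(1%:~R) addrC -intrD floor_itv.
rewrite (_ : _ `&` _ = (fun x => x + t) @^-1` (B `&` `[t, t + 1[%classic)); last first.
  apply/seteqP; split => x /=; rewrite !in_itv/= ct -circle_piD;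
  by move=> [? /andP[? ?]]; split => //; apply/andP; split; lra.
rewrite lebesgue_measure_shift; last exact: measurableI.
have -> : `[t, t + 1[%classic = `[t, 1[%classic `|` `[1, t + 1[%classic :> set R.
  by rewrite -itv_bndbnd_setU// bnd_simp; lra.
have -> : `[0, 1[%classic = `[0, t[%classic `|` `[t, 1[%classic :> set R.
  by rewrite -itv_bndbnd_setU// bnd_simp; lra.
rewrite !setIUr !measureU; do ?exact: measurableI; last 2 first.
- by apply/seteqP; split => // x /= [[_ +] [_]]; rewrite !in_itv/=; lra.
- by apply/seteqP; split => // x /= [[_ +] [_]]; rewrite !in_itv/=; lra.
rewrite addrC; congr (_ + _).
apply: etrans (esym (@lebesgue_measure_shift 1 _ _)) _; first exact: measurableI.
have BD x : B (x + 1) = B x by rewrite /B /preimage/= -(circle_pi_int 1 x).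
congr (lambda _); apply/seteqP; split => x /=; rewrite !in_itv/= BD;
by move=> [? /andP[? ?]]; split => //; apply/andP; split; lra.
Qed.

Lemma torus_haarS n (A : set (torus R n.+1)) :
  torus_haar R n.+1 A =
  (circle_haar R \x torus_haar R n)%E (@torus_cons R n @^-1` A).
Proof. by []. Qed.

Lemma torus_consD n (x y : circle R * torus R n) :
  torus_cons x + torus_cons y = torus_cons (x.1 + y.1, x.2 + y.2).
Proof.
apply: etrans (@add_row_mx _ 1 1 n _ _ _ _) _.
by rewrite /torus_cons (_ : const_mx _ + const_mx _ = const_mx (x.1 + y.1))//;
  apply/matrixP => i j; rewrite !mxE.
Qed.

Lemma torus_haar_shift n (theta : torus R n) (A : set (torus R n)) : measurable A ->
  torus_haar R n ((fun x : torus R n => x + theta) @^-1` A) = torus_haar R n A.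
Proof.
elim: n => [|n IHn] in theta A *.
  move=> mA; congr (torus_haar R 0 _); apply/seteqP.
  by split => x /=; rewrite (_ : x + theta = x)//; apply/rowP => -[].
move=> mA; rewrite !torus_haarS.
have [cx ->] : exists cx, theta = torus_cons cx.
  exists (theta 0 0, (rsubmx (theta : 'rV_(1 + n)))).
  rewrite /torus_cons/= -[LHS](@hsubmxK _ 1 1 n).
  rewrite (_ : lsubmx _ = const_mx (theta 0 0))//.
  apply/matrixP => i j; rewrite !mxE !ord1.
  by congr (fun_of_matrix theta _ _); exact: val_inj.
pose f0 (x : circle R * torus R n) := (x.1 + cx.1, x.2 + cx.2).
have mf : measurable_fun setT f0.
  apply: measurable_fun_pair.
    by apply: (measurableT_comp (measurable_circle_shift _)).
  by apply: (measurableT_comp (measurable_torus_shift _)).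
pose f : {mfun (circle R * torus R n)%type >-> (circle R * torus R n)%type} :=
  HB.pack f0 (isMeasurableFun.Build _ _ _ _ _ mf).
have mC : measurable (@torus_cons R n @^-1` A).
  by rewrite -[X in measurable X]setTI; exact: measurable_torus_cons.
rewrite [RHS](@product_measure_unique _ _ _ _ _ _ _
  (distribution (circle_haar R \x torus_haar R n)%E f))//.
  rewrite /distribution /pushforward; congr product_measure1.
  by apply/seteqP; split => x /=; rewrite torus_consD.
move=> B D mB mD; rewrite /distribution /pushforward.
transitivity ((circle_haar R \x torus_haar R n)%E
  (((fun x : circle R => x + cx.1) @^-1` B) `*`
   ((fun x : torus R n => x + cx.2) @^-1` D))) => //.
rewrite product_measure1E.
- by congr (_ * _)%E; [exact: circle_haar_shift|exact: IHn].
- by rewrite -[X in measurable X]setTI; apply: measurable_circle_shift.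
- by rewrite -[X in measurable X]setTI; apply: measurable_torus_shift.
Qed.

Theorem torus_haar_rotation n (theta : torus R n) (A : set (torus R n)) : measurable A ->
  torus_haar R n (rotation theta @` A) = torus_haar R n A.
Proof. by move=> mA; rewrite torus_rotationE torus_haar_shift. Qed.

Theorem torus_haar_unique n (mu : probability (torus R n) R) :
  (forall theta A, measurable A -> mu (rotation theta @` A) = mu A) ->
  forall A, measurable A -> mu A = torus_haar R n A.
Proof.
move=> muR A mA.
have muS theta : mu ((fun x : torus R n => x + theta) @^-1` A) = mu A.
  rewrite -[RHS](muR (- theta))// torus_rotationE; congr (mu _).
  by apply/funext => x /=; rewrite opprK.
pose S := (fun xy : torus R n * torus R n => xy.1 + xy.2) @^-1` A.
have mS : measurable S.
  by rewrite -[X in measurable X]setTI; exact: measurable_torusD.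
transitivity ((torus_haar R n \x mu)%E S).
  rewrite /product_measure1 (eq_integral (cst (mu A))) ?integral_cst//=.
    by rewrite probability_setT mule1.
  move=> x _ /=; rewrite -(muS x); congr (mu _); apply/seteqP.
  by split => y /=; rewrite /xsection/= inE /S/= addrC.
rewrite (product_measure_unique (m' := (torus_haar R n \x^ mu)%E))//.
  rewrite /= /product_measure2 (eq_integral (cst (torus_haar R n A))) ?integral_cst//=.
    by rewrite probability_setT mule1.
  move=> y _ /=; rewrite -(torus_haar_shift y mA); congr (torus_haar R n _).
  by apply/seteqP; split => x /=; rewrite /ysection/= inE.
by move=> B C mB mC; exact: product_measure2E.
Qed.
End haar.

(* Main.v *)
(* On the circle let E_i contain the dyadic shells ]2^-(k+1), 2^-k[ with
   k = i mod r, and pull this partition back to the torus along the first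
   coordinate.  One of the F_m has positive measure, so by Fubini the set A of
   those c over which the fibre of F_m has positive measure is not null.
   Translating a Lebesgue density point of A to 0 makes A meet all small enough
   shells, hence every E_i, in positive measure. *)
Require Import Defs.
From HB Require Import structures.
From mathcomp Require Import all_boot all_order all_algebra.
From mathcomp Require Import all_classical all_reals all_analysis.
From mathcomp Require Import measurable_realfun lra.

Set Implicit Arguments.
Unset Strict Implicit.
Unset Printing Implicit Defensive.

Import Order.TTheory GRing.Theory Num.Theory.
Import numFieldNormedType.Exports.

Local Open Scope classical_set_scope.
Local Open Scope ring_scope.

(** * Partitions, product measures and finite covers *)

Lemma measurable_partition_extend d (T : measurableType d) r
    (U : 'I_r.+1 -> set T) :
  (forall i, measurable (U i)) -> trivIset setT U ->
  exists E : 'I_r.+1 -> set T, [/\ forall i, measurable (E i),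
    trivIset setT E, \bigcup_i E i = setT & forall i, U i `<=` E i].
Proof.
move=> mU tU; pose V := \bigcup_i U i.
have mV : measurable V by exact: countable_bigcup_measurable.
(* All points outside every [U i] go to the piece of index 0; the other pieces stay as they are. *)
exists (fun i => if i == ord0 then U i `|` ~` V else U i); split.
- by move=> i; case: eqP => // _; apply: measurableU => //; exact: measurableC.
- move=> i j _ _ [x]; have UV k : U k x -> V x by exists k.
  have [->|_] := eqVneq i ord0; have [->|_] := eqVneq j ord0 => //= -[].
  + by move=> [U0|nV] Uj; [apply: tU => //; exists x|case: nV; exact: UV Uj].
  + by move=> Ui [U0|nV]; [apply: tU => //; exists x|case: nV; exact: UV Ui].
  + by move=> Ui Uj; apply: tU => //; exists x.
- apply/seteqP; split => // x _; have [[i _ Uix]|nVx] := pselect (V x).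
    by exists i => //; case: eqP => // _; left.
  by exists ord0 => //=; right.
- by move=> i x Ux; case: eqP => // _; left.
Qed.

(** Tonelli: the product measure of [S] is the integral of the nonnegative function [phi], and such
    an integral vanishes iff [phi] is zero almost everywhere. *)
Lemma product_measure_gt0 d1 d2 (T1 : measurableType d1)
    (T2 : measurableType d2) (R : realType)
    (m1 : {sigma_finite_measure set T1 -> \bar R})
    (m2 : {sigma_finite_measure set T2 -> \bar R}) (S : set (T1 * T2)) :
  measurable S ->
  (0 < (m1 \x m2) S)%E = (0 < m1 [set x | 0 < m2 (xsection S x)])%E.
Proof.
move=> mS; pose phi x := m2 (xsection S x).
have mphi : measurable_fun setT phi by exact: measurable_fun_xsection.
have mP : measurable [set x | (0 < phi x)%E].
  by rewrite -[X in measurable X]setTI; exact: emeasurable_fun_o_infty.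
rewrite !measure_gt0; congr negb; apply/eqP/eqP => [S0|P0].
  have /ae_eq_integral_abs : (\int[m1]_(x in setT) `|phi x| = 0)%E.
    by rewrite -[RHS]S0; apply: eq_integral => x _; rewrite gee0_abs.
  move=> /(_ measurableT mphi) ae0; apply/negligibleP => //.
  apply: negligibleS ae0 => x /= + /(_ I) phi0.
  by rewrite -/(phi x) phi0 ltxx.
transitivity (\int[m1]_(x in setT) `|phi x|)%E.
  by apply: eq_integral => x _; rewrite gee0_abs.
apply/ae_eq_integral_abs => //.
move/negligibleP : P0 => /(_ mP); apply: negligibleS => x /=.
by rewrite /phi measure_gt0 => /not_implyP[_ /eqP].
Qed.

(** A finite union of null sets is null, so it cannot be a whole probability space. *)
Lemma finite_cover_gt0 d (T : measurableType d) (R : realType)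
    (P : probability T R) t (F : 'I_t -> set T) :
  (forall j, measurable (F j)) -> setT `<=` \bigcup_j F j ->
  exists m, (0 < P (F m))%E.
Proof.
move=> mF FT; apply/not_existsP => F0.
have : P.-negligible [set: T].
  apply: (@negligibleS _ _ _ _ (\big[setU/set0]_(j < t) F j)).
    by move=> x /FT[j _ Fj]; rewrite -bigcup_pred; exists j.
  apply: big_ind => [|A B|j _]; [exact: negligible_set0|exact: negligibleU|].
  apply/negligibleP => //; apply/eqP; rewrite -[_ == _]negbK -measure_gt0.
  by apply/negP; exact: F0.
move=> N; have /eqP : P setT = 0%E by exact: (negligibleP P measurableT).1 N.
by rewrite probability_setT onee_eq0.
Qed.

(** * Dyadic shells and Lebesgue density on the line *)

Section shells.
Variable R : realType.
Local Notation lambda := (@lebesgue_measure R).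

(** Open, so that the image in the circle is open and hence Borel; one-sided, so that the shells at
    0 lie in ]0, 1[, where the quotient map is injective. *)
Definition shell (x : R) (k : nat) : set (measurableTypeR R) :=
  `]x + 2^-1 ^+ k.+1, x + 2^-1 ^+ k[%classic.

(** Almost every point of [A] is a density point of [A]; since [A] is not null, it contains such a
    point, and this is the centre [x]. *)
Lemma lebesgue_density_shell (A : set (measurableTypeR R)) :
  measurable A -> (0 < lambda A)%E ->
  exists x, \forall k \near \oo, (0 < lambda (A `&` shell x k))%E.
Proof.
move=> mA A0; have [x [Ax]] : exists x, A x /\
    (lambda (A `&` ball x r) * (lambda (ball x r))^-1)%E
      @[r --> (0:R)^'+] --> (\1_A x)%:E.
  apply: contrapT => /forallNP nA; move: A0; rewrite measure_gt0 => /eqP; apply.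
  apply/negligibleP => //; apply: negligibleS (lebesgue_density mA) => x Ax /= cx.
  exact: (nA x).
rewrite indicE mem_set// => cvgA; exists x.
have h0 k : 0 < 2^-1 ^+ k :> R by rewrite exprn_gt0// invr_gt0.
(* 3/4 is the share of a ball of radius h that lies outside its shell: (2h - h/2) / 2h. *)
have A34 : \forall r \near (0:R)^'+,
    ((3 / 4)%:E < lambda (A `&` ball x r) * (lambda (ball x r))^-1)%E.
  by apply: (cvgA [set y | ((3 / 4)%:E < y)%E]); apply: open_ereal_gt';
    rewrite lte_fin mulr1n; lra.
have h1 : `|2^-1 : R| < 1 by rewrite gtr0_norm; lra.
(* [A34] concerns positive radii near 0, so composing it with the geometric sequence leaves a
   positivity premise, discharged by [h0]. *)
have : \forall k \near \oo, 0 < 2^-1 ^+ k :> R ->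
    ((3 / 4)%:E < lambda (A `&` ball x (2^-1 ^+ k)) *
                  (lambda (ball x (2^-1 ^+ k)))^-1)%E.
  exact: (cvg_expr h1 A34).
apply: filterS => k /(_ (h0 k)).
rewrite lebesgue_measure_ball ?(ltW (h0 _))// inver mulrn_eq0.
rewrite (gt_eqF (h0 k))/= lte_pdivlMr ?mulrn_wgt0//.
rewrite measure_gt0; apply: contraTneq => S0; rewrite -leNgt.
(* The shell fills a quarter of the ball, so missing it contradicts A34. *)
rewrite /shell exprS in S0 *; move: (2^-1 ^+ k) (h0 k) S0 => h hpos S0.
have -> : A `&` ball x h = (A `&` `]x - h, x + 2^-1 * h]%classic) `|`
    (A `&` `]x + 2^-1 * h, x + h[%classic).
  rewrite -setIUr ball_itv -itv_bndbnd_setU// bnd_simp; lra.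
have mI (i : interval R) : measurable (A `&` [set` i]) by exact: measurableI.
rewrite measureU0 ?(le_trans (le_measure _ _ _ (@subIsetr _ _ _)))//= ?inE//.
rewrite lebesgue_measure_itv/= lte_fin -EFinB -EFinM; case: ifP => _.
  by rewrite lee_fin; lra.
by rewrite lee_fin; lra.
Qed.

(** * Shells on the circle *)

Definition circle_shell (k : nat) : set (circle R) :=
  \pi_(circle R)%qT @` shell 0 k.

Lemma circle_shell_measurable k : measurable (circle_shell k).
Proof. by apply: measurable_open; apply: circle_pi_open; exact: interval_open. Qed.

Lemma shell_itv01 k x : shell 0 k x -> 0 < x < 1.
Proof.
rewrite /shell /= in_itv/= !add0r => /andP[x0 x1]; apply/andP; split.
  by rewrite (le_lt_trans _ x0)// exprn_ge0// invr_ge0.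
by rewrite (lt_le_trans x1)// exprn_ile1// ?invr_ge0// invf_le1// ler1n.
Qed.

Lemma shell_inj k l x : shell 0 k x -> shell 0 l x -> k = l.
Proof.
wlog kl : k l / (k <= l)%N.
  move=> W; case: (leqP k l) => [|/ltnW] kl xk xl; [|apply/esym];
    exact: W kl _ _.
rewrite /shell /= !in_itv/= !add0r => /andP[xk _] /andP[_ xl].
apply/eqP; rewrite eqn_leq kl/= leqNgt; apply/negP => {}kl.
have := lt_trans xk xl; apply/negP; rewrite -leNgt.
by apply: ler_wiXn2l => //; rewrite ?invr_ge0// invf_le1// ler1n.
Qed.

(** Two lifts in ]0, 1[ of one point differ by an integer of absolute value below 1, hence coincide;
    disjointness then comes from the shells on the line. *)
Lemma circle_shell_trivI : trivIset setT circle_shell.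
Proof.
move=> k l _ _ [_ [[u uk <-] [v vl /circle_pi_eq /intrP[m vum]]]].
suff uv : u = v by apply: (@shell_inj k l u) => //; rewrite uv.
have /andP[u0 u1] := shell_itv01 uk; have /andP[v0 v1] := shell_itv01 vl.
have m0 : m = 0.
  have : (`|m|%:~R < 1%:~R :> R) by rewrite intr_norm -vum ltr_norml; lra.
  by rewrite ltr_int; case: m {vum} => [[]|].
by apply/eqP; rewrite -subr_eq0 -opprB vum m0 oppr0.
Qed.

(** Lift [A] to the periodic set [B], take a density point [x] of [B], and let [c] be its class:
    translation by [x] carries the shells at 0 to the shells at [x]. *)
Lemma circle_haar_shell_gt0 (A : set (circle R)) :
  measurable A -> (0 < circle_haar R A)%E ->
  exists c : circle R, \forall k \near \oo,
    (0 < circle_haar R ((fun x => x + c)%R @^-1` A `&` circle_shell k))%E.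
Proof.
move=> mA; rewrite circle_haarE//.
set B := \pi_(circle R)%qT @^-1` A => B0.
have mB : measurable (B : set (measurableTypeR R)).
  by rewrite -[X in measurable X]setTI; exact: measurable_circle_pi.
have [x xP] : exists x, \forall k \near \oo, (0 < lambda (B `&` shell x k))%E.
  apply: lebesgue_density_shell => //; apply: lt_le_trans B0 _.
  by apply: le_measure => //; rewrite ?inE//; exact: measurableI.
exists (\pi_(circle R)%qT x); apply: filterS xP => k /lt_le_trans; apply.
have mAx : measurable ((fun y : circle R => y + \pi_(circle R)%qT x) @^-1` A).
  by rewrite -[X in measurable X]setTI; exact: measurable_circle_shift.
have mS := measurableI _ _ mAx (circle_shell_measurable k).
have mBk : measurable (B `&` shell x k).
  by apply: measurableI => //; exact: measurable_itv.
(* An inclusion suffices: [B] meets the shell at [x] in a set whose translate by [- x] lies in the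
   fundamental domain [0, 1[, inside the lift of the circle set. *)
rewrite circle_haarE// -(lebesgue_measure_shift x mBk).
apply: le_measure; rewrite ?inE.
- rewrite -[X in measurable X]setTI.
  by apply: (@measurable_funD _ (measurableTypeR R) _ setT id (cst x)).
- apply: measurableI; last exact: measurable_itv.
  by rewrite -[X in measurable X]setTI; exact: measurable_circle_pi.
move=> y [By yk].
have {}yk : shell 0 k y.
  by move: yk; rewrite /shell /= !in_itv/= => /andP[? ?]; apply/andP; split; lra.
split; first by split; [rewrite /preimage/= -circle_piD|exists y].
by have := shell_itv01 yk; rewrite /= in_itv/= => /andP[/ltW -> ->].
Qed.

End shells.

Theorem theorem1p4 (R : realType) (n r t : nat)
    (hn : (1 <= n)%N) (hr : (2 <= r)%N) (ht : (2 <= t)%N) :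
  exists E : 'I_r -> set (torus R n),
    [/\ forall i, measurable (E i),
        trivIset [set: 'I_r] E,
        \bigcup_i E i = [set: torus R n] &
        forall F : 'I_t -> set (torus R n),
          (forall j, measurable (F j)) ->
          [set: torus R n] `<=` \bigcup_j F j ->
          exists (m : 'I_t) (theta : torus R n), forall i : 'I_r,
            (0 < torus_haar R n ((rotation theta @` F m) `&` E i))%E].
Proof.
case: n hn => // n _; case: r hr => // r _.
pose U (i : 'I_r.+1) : set (circle R) :=
  \bigcup_(k in [set k | k %% r.+1 = i]%N) circle_shell k.
have [|i j _ _ [x [[k ki xk] [l lj xl]]]|E [mE tE ET UE]] :=
    @measurable_partition_extend _ _ r U.
- move=> i; apply: bigcup_measurable => k _; exact: circle_shell_measurable.
- apply: val_inj; rewrite /= -ki -lj; congr (_ %% _)%N.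
  by apply: (@circle_shell_trivI R) => //; exists x.
pose p (x : torus R n.+1) := x 0 0.
have mp : measurable_fun setT p by exact: measurable_torus_coord.
exists (fun i => p @^-1` E i); split.
- by move=> i; rewrite -[X in measurable X]setTI; exact: mp.
- by move=> i j _ _ [x [xi xj]]; apply: tE => //; exists (p x).
- by apply/seteqP; split => // x _; have [i _ xi] : (\bigcup_i E i) (p x)
    by [rewrite ET]; exists i.
move=> F mF FT; have [m Fm0] := finite_cover_gt0 (torus_haar R n.+1) mF FT.
exists m; pose G := @torus_cons R n @^-1` F m.
have mG : measurable G.
  by rewrite -[X in measurable X]setTI; exact: measurable_torus_cons.
pose A := [set c | (0 < torus_haar R n (xsection G c))%E].
have mA : measurable A.
  rewrite -[X in measurable X]setTI; apply: emeasurable_fun_o_infty => //.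
  exact: measurable_fun_xsection.
have [c cP] : exists c : circle R, \forall k \near \oo,
    (0 < circle_haar R ((fun x => x + c)%R @^-1` A `&` circle_shell k))%E.
  apply: circle_haar_shell_gt0 => //.
  by move: Fm0; rewrite torus_haarS product_measure_gt0.
(* Rotating by [- c] in the first coordinate moves [A] to its preimage under adding [c]; the other
   coordinates are fixed. *)
exists (torus_cons (- c, 0)) => i; rewrite torus_rotationE torus_haarS.
set S := _ @^-1` _.
have mS : measurable S.
  rewrite -[X in measurable X]setTI; apply: measurable_torus_cons => //.
  apply: measurableI; last by rewrite -[X in measurable X]setTI; exact: mp.
  by rewrite -[X in measurable X]setTI; exact: measurable_torus_shift.
rewrite product_measure_gt0//.
have [k ki ck] : exists2 k, (k %% r.+1 = i)%N &
   (0 < circle_haar R ((fun x => x + c)%R @^-1` A `&` circle_shell k))%E.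
  (* This index is at least the threshold [K] and has residue [i]: every residue class contains
     arbitrarily small shells. *)
  case: cP => K _ KP; exists (K * r.+1 + i)%N.
    by rewrite modnMDl modn_small.
  by apply: KP => /=; rewrite (leq_trans (leq_pmulr K (ltn0Sn r)))// leq_addr.
apply: lt_le_trans ck _; apply: le_measure; rewrite ?inE.
- apply: measurableI; last exact: circle_shell_measurable.
  by rewrite -[X in measurable X]setTI; exact: measurable_circle_shift.
- rewrite -[X in measurable X]setTI; apply: emeasurable_fun_o_infty => //.
  exact: measurable_fun_xsection.
(* The partition depends only on the first coordinate, so over [b] in the shell the condition [E i]
   holds on the whole fibre, and what remains is the fibre of [G] over [b + c], which has positive
   measure by [Ab]. *)
move=> b [/= Ab bk]; rewrite (_ : xsection _ b = xsection G (b + c))//.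
have Eb : E i b by apply: UE; exists k.
have pb y : p (torus_cons (b, y)) = b.
  rewrite /p /torus_cons (_ : 0 = lshift n (0 : 'I_1)) ?(@row_mxEl _ 1 1 n) ?mxE//.
  exact: val_inj.
have shiftE y : torus_cons (b, y) - torus_cons (- c, 0) = torus_cons (b + c, y).
  by apply: (addIr (torus_cons (- c, 0))); rewrite subrK torus_consD/= addrK addr0.
apply/seteqP; split => y /=; rewrite /xsection /= !inE /S /G /= pb shiftE //.
by case.
Qed.
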